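(* Let $p$ be a prime. If $G$ is a nonabelian $p$-group with a cyclic commutator subgroup $G'$ of order $p$, then $$\rho_0(G) \leq p.$$
   Context: A $p$-group means a finite group of order $p^n$ for a prime $p$ and a positive integer $n$. A triple $(S,T,U)$ of subgroups of a group $G$ is a subgroup TPP triple of $G$ if for all $s\in S$, $t\in T$, $u\in U$ one has $stu=1 \iff s=t=u=1$. For a finite group $G$ the subgroup TPP ratio is $\rho_0(G) := \max \frac{|S||T||U|}{|G|}$, where the maximum is over all subgroup TPP triples $(S,T,U)$ of $G$. *)

(* Defs.v *)
From HB Require Import structures.
From mathcomp Require Import all_boot all_order all_algebra.
From mathcomp Require Import all_fingroup all_solvable.

Set Implicit Arguments.
Unset Strict Implicit.
Unset Printing Implicit Defensive.

Import GroupScope.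

Definition subgroup_TPP (gT : finGroupType) (G S T U : {group gT}) : bool :=
  [&& S \subset G, T \subset G, U \subset G &
    [forall s in S, forall t in T, forall u in U,
       (s * t * u == 1) == [&& s == 1, t == 1 & u == 1]]].

Definition TPP_ratio (gT : finGroupType) (G S T U : {group gT}) : rat :=
  ((#|S| * #|T| * #|U|)%N%:R / #|G|%:R)%R.

(* The default value 0 of the maximum is never reached: the trivial triple    *)
(* (1, 1, 1) is always a subgroup TPP triple, with positive ratio 1 / #|G|.   *)
Definition rho0 (gT : finGroupType) (G : {group gT}) : rat :=
  \big[Num.max/0%R]_(X : {group gT} * {group gT} * {group gT} |
                      subgroup_TPP G X.1.1 X.1.2 X.2)
    TPP_ratio G X.1.1 X.1.2 X.2.

(* Main.v *)
Require Import Defs.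
From mathcomp Require Import all_boot all_order all_algebra.
From mathcomp Require Import all_fingroup all_solvable.
From mathcomp Require Import zify ring.

(** Write Z = G'. Being normal of prime order in a p-group, Z is central, and
    U either contains Z or meets it trivially.

    If Z <= U then U is normal in G, and the TPP condition says that
    (s, t) |-> st induces an injection of S x T into G / U; hence
    |S||T||U| <= |G| ([tpp_card_normal]).

    Otherwise U is abelian, since U' <= U :&: Z = 1. The product map
    f(s, t, u) = stu becomes a morphism from S x T x U to the abelian group
    G / Z, so its kernel K = {(s, t, u) | stu \in Z} has index at most
    |G| / p, and it suffices to show |K| <= p^2. On K the map f takes values
    in Z, equals 1 only at the identity, and is quadratic: for h = (a, b, c)
    and k = (s, t, u) in K,

      f(hk) = f(h) f(k) [s, b]              ([mul3_commg]),

    where [s, b] is a morphism in k. For odd p this makes K elementary abelian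
    and f an anisotropic quadratic function over the field with p elements, so
    that K has dimension at most 2. A second moment argument gives the bound
    uniformly in p. For h <> 1, f(hk) = f(k) means that the morphism
    k |-> [s, b] takes the nontrivial value f(h)^-1, which happens for at most
    |K| / p elements k.
    Summing over h bounds the number of pairs on which f agrees, that is, the
    sum of the squares of the sizes of the fibers of f; as the fiber over 1 has
    a single element, the Cauchy-Schwarz inequality on the other p - 1 fibers
    forces |K| <= p^2 ([card_le_sqr_of_collisions]). *)

Set Implicit Arguments.
Unset Strict Implicit.
Unset Printing Implicit Defensive.

(** * Second moments of fiber sizes *)

Lemma sum_sqr_le (I : finType) (A : {set I}) (x : I -> nat) :
  (\sum_(i in A) x i) ^ 2 <= #|A| * \sum_(i in A) x i ^ 2.
Proof.
have -> : #|A| * \sum_(i in A) x i ^ 2 = \sum_(i in A) \sum_(j in A) x j ^ 2.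
  by rewrite sum_nat_const.
rewrite -(leq_pmul2l (ltn0Sn 1)) [X in _ <= X]mul2n -addnn.
rewrite [X in _ <= X + _]exchange_big -big_split /=.
rewrite -mulnn big_distrlr /= big_distrr /=.
apply: leq_sum => i _; rewrite big_distrr -big_split /=.
by apply: leq_sum => j _; rewrite nat_Cauchy.
Qed.

Lemma sum_card_fibers (aT rT : finType) (A : {set aT}) (Z : {set rT})
    (f : aT -> rT) :
  {in A, forall a, f a \in Z} ->
  \sum_(z in Z) #|[set a in A | f a == z]| = #|A|.
Proof.
move=> fZ; rewrite -[RHS]sum1_card (partition_big f (mem Z)) //=.
apply: eq_bigr => z _; rewrite sum1dep_card.
by apply: eq_card => a; rewrite !inE.
Qed.

(** Both sides count the pairs (k, k') with f k' = f k; the right-hand side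
    writes k' as hk and counts along h. *)
Lemma sum_sqr_card_fibers (aT : finGroupType) (rT : finType) (K : {group aT})
    (Z : {set rT}) (f : aT -> rT) :
  {in K, forall k, f k \in Z} ->
  \sum_(z in Z) #|[set k in K | f k == z]| ^ 2 =
  \sum_(h in K) #|[set k in K | f (h * k)%g == f k]|.
Proof.
move=> fZ.
transitivity (\sum_(k in K) #|[set k' in K | f k' == f k]|).
  rewrite (partition_big f (mem Z)) //=; apply: eq_bigr => z _.
  rewrite -mulnn -sum_nat_const; apply: eq_big => [k | k]; rewrite !inE //.
  by move=> /andP[_ /eqP->].
have cardE (P : pred aT) : #|[set k in K | P k]| = \sum_(k in K) P k.
  rewrite -sum1_card big_mkcond [RHS]big_mkcond /=; apply: eq_bigr => k _.
  by rewrite inE; case: (k \in K); case: (P k).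
under eq_bigr => k _ do rewrite cardE.
under [RHS]eq_bigr => h _ do rewrite cardE.
rewrite [RHS]exchange_big; apply: eq_bigr => k Kk /=.
rewrite (reindex_inj (mulIg k)) /=.
by apply: eq_bigl => h; rewrite groupMr.
Qed.

(** With M = |K|, q = |Z| - 1 and C the number of collisions f (h * k) = f k
    with h <> 1, the fibers over Z minus z0 have total size M - 1 and sum of
    squares M - 1 + C, so that (M - 1)^2 <= q (M - 1 + C) by Cauchy-Schwarz,
    while (q + 1) C <= (M - 1) M by hypothesis. Eliminating C gives
    M <= (q + 1)^2. *)
Lemma card_le_sqr_of_collisions (aT : finGroupType) (rT : finType)
    (K : {group aT}) (Z : {set rT}) (z0 : rT) (f : aT -> rT) :
  z0 \in Z ->
  {in K, forall k, f k \in Z} ->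
  {in K, forall k, (f k == z0) = (k == 1%g)} ->
  {in (K^#)%g, forall h, #|Z| * #|[set k in K | f (h * k)%g == f k]| <= #|K|} ->
  #|K| <= #|Z| ^ 2.
Proof.
move=> Zz0 fZ f1 fh.
have n1 : #|[set k in K | f k == z0]| = 1%N.
  rewrite -(cards1 (1%g : aT)); apply: eq_card => k; rewrite !inE.
  case Kk: (k \in K) => /=; first exact: f1.
  by apply/esym/eqP => k1; rewrite k1 group1 in Kk.
have sumN := @sum_card_fibers _ _ _ _ _ fZ.
have sumN2 := @sum_sqr_card_fibers _ _ _ _ _ fZ.
rewrite (big_setD1 z0) //= n1 in sumN.
rewrite (big_setD1 z0) //= n1 (big_setD1 1%g) //= in sumN2.
have CS := @sum_sqr_le _ (Z :\ z0) (fun z => #|[set k in K | f k == z]|).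
have coll : #|Z| * \sum_(h in (K^#)%g) #|[set k in K | f (h * k)%g == f k]|
            <= #|(K^#)%g| * #|K|.
  by rewrite big_distrr -sum_nat_const; apply: leq_sum => h; apply: fh.
have c1 : #|[set k in K | f (1 * k)%g == f k]| = #|K|.
  by apply: eq_card => k; rewrite !inE mul1g eqxx andbT.
rewrite c1 in sumN2.
move: CS coll sumN sumN2 (cardsD1 1%g K) (cardsD1 z0 Z); rewrite group1 Zz0.
move: (\sum_(i in Z :\ z0) _) (\sum_(i in Z :\ z0) _) (\sum_(h in (K^#)%g) _).
move: #|(K^#)%g| #|Z :\ z0| #|K| #|Z| => m q M P D1 D2 C CS coll e1 e2 e3 e4.
have eD2 : D2 = m by lia.
have eD1 : D1 = m + C by lia.
have eM : M = m.+1 by lia.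
have eP : P = q.+1 by lia.
subst D1 D2 M P.
have [-> | m_gt0] := posnP m; first by rewrite expn_gt0.
have : q.+1 * m ^ 2 <= q.+1 * (q * (m + C)) by rewrite leq_pmul2l.
have : q * (q.+1 * C) <= q * (m * m.+1) by rewrite leq_mul2l coll orbT.
have -> : q.+1 * (q * (m + C)) = q * q.+1 * m + q * (q.+1 * C) by ring.
move=> leC leCS.
have : m * (q.+1 * m) <= m * (q * q.+1 + q * m.+1).
  by move: leC leCS; rewrite !expnS expn0; lia.
by rewrite leq_pmul2l // !expnS expn0; lia.
Qed.

(** * Products of three subgroups *)

Import GroupScope.

(** A nonempty fiber over z <> 1 is a coset of the kernel, and its existence
    makes f surjective because a group of prime order has no proper nontrivial
    subgroup. *)
Lemma card_fiber_prime_codomain (aT rT : finGroupType) (K : {group aT})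
    (Z : {group rT}) (f : aT -> rT) (z : rT) :
  prime #|Z| -> {in K &, {morph f : x y / x * y}} ->
  {in K, forall k, f k \in Z} -> z != 1 ->
  (#|Z| * #|[set k in K | f k == z]| <= #|K|)%N.
Proof.
move=> prZ fM fZ nz1; pose phi := Morphism fM.
have [-> | [k0]] := set_0Vmem [set k in K | f k == z].
  by rewrite cards0 muln0.
rewrite inE => /andP[Kk0 /eqP fk0].
have imZ : phi @* K = Z.
  apply/eqP; rewrite eqEsubset; apply/andP; split.
    by apply/subsetP => _ /morphimP[k Kk _ ->]; apply: fZ.
  apply: (prime_meetG prZ); apply/trivgPn; exists z => //.
  rewrite inE -fk0 fZ //=; exact: (mem_morphim phi).
have -> : [set k in K | f k == z] = 'ker phi :* k0.
  apply/setP => k; rewrite mem_rcoset !inE groupMr ?groupV //.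
  case Kk: (k \in K) => //=.
  have -> : f (k * k0^-1) = f k * z^-1.
    by rewrite -fk0 -(morphV phi Kk0) -(morphM phi) ?groupV.
  by rewrite -eq_mulgV1.
by rewrite card_rcoset -imZ card_morphim setIid mulnC Lagrange // subsetIl.
Qed.

(** Only the direction of the TPP equivalence that has content; a Prop rather
    than a boolean so that it can be applied to explicit elements. *)
Definition tpp (gT : finGroupType) (S T U : {group gT}) : Prop :=
  forall s t u, s \in S -> t \in T -> u \in U -> s * t * u = 1 ->
  [/\ s = 1, t = 1 & u = 1].

Lemma subgroup_TPP_tpp (gT : finGroupType) (G S T U : {group gT}) :
  subgroup_TPP G S T U -> tpp S T U.
Proof.
case/and4P=> _ _ _ tppSTU s t u Ss Tt Uu /eqP.
move: tppSTU => /forall_inP/(_ s Ss)/forall_inP/(_ t Tt).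
move=> /forall_inP/(_ u Uu)/eqP->.
by case/and3P=> /eqP-> /eqP-> /eqP->.
Qed.

(** The elements stu and tus are conjugate. *)
Lemma tpp_rot (gT : finGroupType) (S T U : {group gT}) :
  tpp S T U -> tpp T U S.
Proof.
move=> tppSTU t u s Tt Uu Ss tus1.
have [|-> -> ->] // := tppSTU s t u Ss Tt Uu.
by apply: (mulIg s); rewrite mul1g -mulgA -mulgA (mulgA t) tus1 mulg1.
Qed.

(** If stu = s't'u', then s'^-1 s, conjugated by t', is an element of S whose
    product with t'^-1 t and u u'^-1 is trivial; so (s, t, u) is determined by
    stu. *)
Lemma tpp_card_normal (gT : finGroupType) (G S T U : {group gT}) :
  tpp S T U -> S <| G -> T \subset G -> U \subset G ->
  (#|S| * #|T| * #|U| <= #|G|)%N.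
Proof.
move=> tppSTU /andP[sSG nSG] sTG sUG.
have injm : {in setX (setX S T) U &, injective (fun x => x.1.1 * x.1.2 * x.2)}.
  move=> [[s t] u] [[s' t'] u']; rewrite !inE /=.
  move=> /andP[/andP[Ss Tt] Uu] /andP[/andP[Ss' Tt'] Uu'] e.
  have NS x : x \in G -> x \in 'N(S) by apply: (subsetP nSG).
  have := tppSTU ((s'^-1 * s) ^ t') (t'^-1 * t) (u * u'^-1).
  rewrite memJ_norm ?NS ?(subsetP sTG) // !groupM ?groupV //.
  case=> //.
    have -> : (s'^-1 * s) ^ t' * (t'^-1 * t) * (u * u'^-1)
              = (s' * t')^-1 * (s * t * u) * u'^-1.
      by rewrite conjgE invMg !mulgA mulgK.
    by rewrite e mulKg mulgV.
  move=> /eqP; rewrite conjg_eq1 -eq_mulVg1 => /eqP es.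
  move=> /eqP; rewrite -eq_mulVg1 => /eqP et /eqP.
  by rewrite -eq_mulgV1 es et => /eqP->.
rewrite -!cardsX -(card_in_imset injm); apply: subset_leq_card.
apply/subsetP => _ /imsetP[[[s t] u] + ->]; rewrite !inE /=.
move=> /andP[/andP[Ss Tt] Uu].
by rewrite !groupM ?(subsetP sSG s) ?(subsetP sTG t) ?(subsetP sUG u).
Qed.

Lemma mul3_mod_der1 (gT : finGroupType) (G Z S T U : {group gT}) :
  S \subset G -> T \subset G -> U \subset G -> G^`(1) \subset Z ->
  Z \subset 'Z(G) ->
  {in setX (setX S T) U &,
    {morph (fun x => coset Z (x.1.1 * x.1.2 * x.2)) : x y / x * y}}.
Proof.
move=> sSG sTG sUG sG'Z sZ [[a b] c] [[s t] u]; rewrite !inE /=.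
move=> /andP[/andP[Sa Tb] Uc] /andP[/andP[Ss Tt] Uu].
have nZG : G \subset 'N(Z).
  by rewrite cents_norm // centsC (subset_trans sZ) // subsetIr.
have NZ x : x \in G -> x \in 'N(Z) by apply: (subsetP nZG).
have [Ga Gs] := (subsetP sSG _ Sa, subsetP sSG _ Ss).
have [Gb Gt] := (subsetP sTG _ Tb, subsetP sTG _ Tt).
have [Gc Gu] := (subsetP sUG _ Uc, subsetP sUG _ Uu).
have cosC x y : x \in G -> y \in G ->
    coset Z x * coset Z y = coset Z y * coset Z x.
  have abGZ : abelian (G / Z) by rewrite sub_der1_abelian.
  by move=> Gx Gy; apply: (centsP abGZ); rewrite mem_quotient.
have cosCA x y w : x \in G -> y \in G ->
    coset Z x * (coset Z y * w) = coset Z y * (coset Z x * w).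
  by move=> Gx Gy; rewrite !mulgA (cosC x y).
rewrite !morphM ?NZ ?groupM //= -!mulgA; congr (_ * _).
by rewrite [in RHS](cosCA c s) // (cosCA b s) // (cosCA c t).
Qed.

(** Moving b past s creates the commutator [s, b], which is then moved to the
    right; moving c past st creates nothing, because st is u^-1 up to a factor
    commuting with c. The hypothesis on c and u is what U abelian provides. *)
Lemma mul3_commg (gT : finGroupType) (a b c s t u : gT) :
  commute [~ s, b] (t * (c * u)) -> commute (s * t * u) c -> commute c u ->
  a * s * (b * t) * (c * u) = a * b * c * (s * t * u) * [~ s, b].
Proof.
move=> cR cw cu.
have cst : commute c (s * t).
  have -> : s * t = s * t * u * u^-1 by rewrite mulgK.
  by apply: commuteM; [exact: commute_sym | apply: commuteV].
move: [~ s, b] (commgC s b) cR => r sb cr.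
have -> : a * s * (b * t) * (c * u) = a * (s * b) * t * c * u.
  by rewrite !mulgA.
rewrite sb -!mulgA; do 2!congr (_ * _).
rewrite cr !mulgA; congr (_ * _ * _).
by rewrite -[RHS]mulgA cst.
Qed.

(** The case of U abelian: the kernel K of the product map to G / Z has order
    at most |Z|^2, and its index is at most |G| / |Z|. *)
Lemma tpp_card_abelian (gT : finGroupType) (G Z S T U : {group gT}) :
  prime #|Z| -> Z \subset 'Z(G) -> G^`(1) \subset Z ->
  S \subset G -> T \subset G -> U \subset G ->
  abelian U -> tpp S T U -> (#|S| * #|T| * #|U| <= #|Z| * #|G|)%N.
Proof.
move=> prZ sZ sG'Z sSG sTG sUG abU tppSTU.
pose f (x : gT * gT * gT) := x.1.1 * x.1.2 * x.2.
pose X := [group of setX (setX S T) U].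
pose phi := Morphism (mul3_mod_der1 sSG sTG sUG sG'Z sZ).
pose K := 'ker phi.
have sZG : Z \subset G by rewrite (subset_trans sZ) // center_sub.
have cZ z x : z \in Z -> x \in G -> commute z x.
  by move=> Zz Gx; have /centerP[_] := subsetP sZ z Zz; apply.
have nZG : G \subset 'N(Z).
  by rewrite cents_norm // centsC (subset_trans sZ) // subsetIr.

have XP s t u : (s, t, u) \in X -> [/\ s \in S, t \in T & u \in U].
  by rewrite !inE => /andP[/andP[]].
have GX x : x \in X -> f x \in G.
  case: x => [[s t] u] /XP[Ss Tt Uu] /=.
  by rewrite /f !groupM ?(subsetP sSG s) ?(subsetP sTG t) ?(subsetP sUG u).
have KX x : x \in K -> x \in X by move/(subsetP (subsetIl _ _)).
have fZ : {in K, forall x, f x \in Z}.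
  move=> x Kx; have Gfx := GX x (KX x Kx).
  exact: (coset_idr (subsetP nZG _ Gfx) (mker Kx)).
have f1 : {in K, forall x, (f x == 1) = (x == 1)}.
  move=> [[s t] u] /KX/XP[Ss Tt Uu]; apply/eqP/eqP; last first.
    by case=> -> -> ->; rewrite /f !mulg1.
  by move=> /(tppSTU s t u Ss Tt Uu)[-> -> ->].
have RZ x y : x \in G -> y \in G -> [~ x, y] \in Z.
  by move=> Gx Gy; rewrite (subsetP sG'Z) // mem_commg.
(* For h = (a, b, c) the collisions f (h * k) = f k lie in the fiber of the
   morphism k |-> [~ k.1.1, b] over (f h)^-1. *)
have coll : {in K^#, forall h,
    (#|Z| * #|[set k in K | f (h * k)%g == f k]| <= #|K|)%N}.
  move=> [[a b] c] /setD1P[h1 Kh].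
  have [Sa Tb Uc] := XP _ _ _ (KX _ Kh).
  have Gb := subsetP sTG b Tb.
  have := @card_fiber_prime_codomain _ _ K Z (fun k => [~ k.1.1, b])
            (f (a, b, c))^-1 prZ.
  rewrite eq_invg1 f1 // h1 => /(_ _ _ isT) H.
  apply: leq_trans (H _ _) => [|[[s t] u] [[s' t'] u']|[[s t] u]].
  - rewrite leq_mul2l subset_leq_card ?orbT //.
    apply/subsetP => [[[s t] u]]; move=> /setIdP[Kk /eqP fhk].
    apply/setIdP; split=> //=.
    have [Ss Tt Uu] := XP _ _ _ (KX _ Kk).
    have [Gs Gt] := (subsetP sSG _ Ss, subsetP sTG _ Tt).
    have [Gc Gu] := (subsetP sUG _ Uc, subsetP sUG _ Uu).
    have Zstu : s * t * u \in Z := fZ _ Kk.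
    have Zabc : a * b * c \in Z := fZ _ Kh.
    have Zsb := RZ s b Gs Gb.
    have Gtcu : t * (c * u) \in G by rewrite !groupM.
    have fM := mul3_commg a (cZ _ _ Zsb Gtcu) (cZ _ _ Zstu Gc)
                           (centsP abU c Uc u Uu).
    rewrite eq_sym eq_invg_mul; apply/eqP/(mulgI (s * t * u)).
    have Gstu : s * t * u \in G by rewrite (subsetP sZG).
    by rewrite mulg1 mulgA -(cZ _ _ Zabc Gstu) -fM; apply: fhk.
  - move=> /KX/XP[Ss Tt Uu] /KX/XP[Ss' Tt' Uu'].
    have [Gs Gs'] := (subsetP sSG _ Ss, subsetP sSG _ Ss').
    rewrite /= commMgJ; congr (_ * _).
    by apply/conjg_fixP/commgP; apply: cZ; rewrite ?RZ.
  - by move=> /KX/XP[Ss _ _]; rewrite RZ ?(subsetP sSG s).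
have cardK := card_le_sqr_of_collisions (group1 Z) fZ f1 coll.
have imG : phi @* X \subset G / Z.
  apply/subsetP => _ /morphimP[x _ Xx ->]; exact: mem_quotient (GX x Xx).
have := subset_leq_card imG.
rewrite card_quotient // => cardI.
have cardX : #|X| = (#|phi @* X| * #|K|)%N.
  by rewrite card_morphim setIid mulnC Lagrange // subsetIl.
rewrite -2!cardsX -[#|setX _ _|]/#|X| cardX -(Lagrange sZG).
by apply: leq_trans (leq_mul cardI cardK) _; rewrite mulnC mulnA mulnn.
Qed.

Theorem theorem4p1 (gT : finGroupType) (G : {group gT}) (p : nat) :
  prime p ->
  (p.-group G)%g ->
  ~~ (abelian G)%g ->
  (cyclic G^`(1))%g ->
  #|(G^`(1))%g| = p ->
  (rho0 G <= p%:R)%R.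
Proof.
move=> pr_p pG _ _ cardG'; set Z := (G^`(1))%G.
have prZ : prime #|Z| by rewrite cardG'.
have sZ : Z \subset 'Z(G).
  apply: (prime_meetG prZ).
  rewrite (meet_center_nil (pgroup_nil pG)) ?der_normal //.
  by rewrite -cardG_gt1 prime_gt1.
apply: (big_ind (fun r => r <= p%:R)%R) => [|x y xp yp|[[S T] U] /= STU].
- exact: Num.Theory.ler0n.
- by rewrite Order.TotalTheory.ge_max xp.
have tppSTU := subgroup_TPP_tpp STU.
have /and4P[sSG sTG sUG _] := STU.
rewrite /TPP_ratio Num.Theory.ler_pdivrMr ?Num.Theory.ltr0n ?cardG_gt0 //.
rewrite -GRing.natrM Num.Theory.ler_nat -cardG'.
(* As #|Z| is prime, either Z meets U trivially or Z is contained in U. *)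
have [tiUZ | ntUZ] := eqVneq (Z :&: U) 1.
  apply: (tpp_card_abelian prZ sZ) => //.
  apply/derG1P/trivgP; rewrite -tiUZ subsetI.
  by rewrite dergS // der_sub.
have nsUG : U <| G by rewrite sub_der1_normal // (prime_meetG prZ).
have tppUST := tpp_rot (tpp_rot tppSTU).
rewrite mulnC mulnA; apply: leq_trans (tpp_card_normal tppUST nsUG sSG sTG) _.
by rewrite leq_pmull.
Qed.
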